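(* Let $a>0$ and $D>0$. If the frequency $\omega>0$ satisfies $$\omega\neq \frac{k\pi}{D},\qquad k\in\mathbb{N},$$ then the solution of the trajectory generation problem defined by $$\int_0^D \beta(y,t)\,dy = a\sin(\omega t),\qquad \partial_{tt}\beta(x,t)=\partial_{xx}\beta(x,t),\qquad \partial_x\beta(0,t)=0,\qquad \beta(D,t)=S(t)$$ is $$\beta(x,t)=\frac{a\omega}{\sin(\omega D)}\cos(\omega x)\sin(\omega t).$$ In particular, the additive perturbation signal $S(t)$ is $$S(t)=\beta(D,t)=\frac{a\omega}{\sin(\omega D)}\cos(\omega D)\sin(\omega t).$$
   Context: Here $\beta:[0,D]\times\mathbb{R}^+\to\mathbb{R}$, where $D>0$ is the upper bound of the spatial domain, and $a>0$ and $\omega>0$ are the amplitude and frequency parameters of the perturbation. Solving the trajectory generation problem consists in determining $\beta(x,t)$ such that the four displayed equations are satisfied. The signal $S(t)$ is the boundary signal (additive perturbation signal of an extremum seeking control system) to be designed so that, after propagation through the wave equation, the integral of $\beta$ over $[0,D]$ equals $a\sin(\omega t)$.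
   Formalization: Uniqueness of the solution is claimed only for the displayed boundary signal S(t); with S free it fails, since adding cos(kπx/D)cos(kπt/D), k≥1, to β gives another solution with a different S. *)

(* Defs.v *)
From Stdlib Require Import Reals.
From Coquelicot Require Import Coquelicot.
Open Scope R_scope.

(* Coquelicot's [is_derive] with the filter [locally x] restricted to [A]:
   at an endpoint of an interval [A] this is the one-sided derivative, and
   values of [f] outside [A] play no role. *)
Definition is_derive_within (A : R -> Prop) (f : R -> R) (x l : R) : Prop :=
  filterdiff f (within A (locally x)) (fun h : R => scal h l).

Definition space (D x : R) : Prop := 0 <= x <= D.
Definition time (t : R) : Prop := 0 <= t.
Definition space_time (D : R) (p : R * R) : Prop :=
  space D (fst p) /\ time (snd p).

(* Functions on [0,D] x [0,+oo) are represented by total functions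
   [R -> R -> R], of which only the values on [space_time D] matter. *)
Definition C1_partials (D : R) (f fx ft : R -> R -> R) : Prop :=
  (forall x t, space D x -> time t ->
     is_derive_within (space D) (fun y => f y t) x (fx x t)) /\
  (forall x t, space D x -> time t ->
     is_derive_within time (fun s => f x s) t (ft x t)) /\
  continuous_on (space_time D) (fun p : R * R => fx (fst p) (snd p)) /\
  continuous_on (space_time D) (fun p : R * R => ft (fst p) (snd p)).

(* [beta] is a classical solution: it is twice continuously differentiable on
   [0,D] x [0,+oo), with one-sided derivatives on the boundary.  No initial
   data are prescribed. *)
Definition trajectory_generation (D a omega : R)
    (beta : R -> R -> R) (S : R -> R) : Prop :=
  exists bx bt bxx bxt btx btt : R -> R -> R,
    C1_partials D beta bx bt /\
    C1_partials D bx bxx bxt /\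
    C1_partials D bt btx btt /\
    (forall t, time t ->
       is_RInt (fun y => beta y t) 0 D (a * sin (omega * t))) /\
    (forall x t, space D x -> time t -> btt x t = bxx x t) /\
    (forall t, time t -> bx 0 t = 0) /\
    (forall t, time t -> beta D t = S t).

(* Main.v *)
Require Import Defs.
From Stdlib Require Import Reals Lra ZArith.
From Coquelicot Require Import Coquelicot.
Open Scope R_scope.

(** The standing wave solves the problem by direct computation: its integral
    over [0,D] produces the factor sin (omega * D) / omega, which the
    amplitude cancels, and the condition on omega says precisely that
    sin (omega * D) does not vanish.

    Uniqueness for a prescribed boundary signal is a sideways argument.  The
    difference w of two solutions is a C^2 solution of the wave equation with
    w_x(0,t) = 0, w(D,t) = 0 and vanishing integral over [0,D].  Differentiating
    the integral twice in time and using w_tt = w_xx gives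
    w_x(D,t) - w_x(0,t) = 0, so both Cauchy data of w vanish on the side x = D
    ([flux_balance]).  The Riemann invariants w_t - w_x and w_t + w_x are
    constant on the lines x - t = const and x + t = const
    ([riemann_invariant_constant]).  Each line x - t = const, followed forward
    in time, ends on x = D, hence w_t - w_x = 0 everywhere; each line
    x + t = const, followed forward in time, ends on x = 0, where
    w_x = 0 makes the two invariants coincide, hence w_t + w_x = 0 as well.  So
    w_x = 0 and w(x,t) = w(D,t) = 0 ([wave_unique_continuation]).  Initial
    data are never involved: following characteristics forward in time always
    reaches a side.

    The boundary signal has to be prescribed in this argument: the modes
    cos(k pi x / D) cos(k pi t / D), k >= 1, satisfy all the homogeneous
    conditions except w(D,t) = 0.  The assertion on S' concerns the signals
    compatible with the standing wave itself, for which beta(D,t) = S'(t) is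
    one of the conditions of the problem.

    Regularity is one-sided on the boundary.  Derivatives are therefore
    computed in the interior and conclusions are carried to the boundary by
    continuity; results about functions on the whole line are applied after
    composing with the retraction [clip] onto [0,D]. *)

(** * One-sided derivatives and continuity on subsets *)

Lemma is_derive_within_locally (A : R -> Prop) (f : R -> R) (x l : R) :
  locally x A -> is_derive_within A f x l -> is_derive f x l.
Proof.
  intros HA [Hlin Hdom]; split; [exact Hlin|].
  intros y Hy eps.
  assert (Hy' : is_filter_lim (within A (locally x)) y).
  { intros P HP; unfold within. apply filter_imp with (2 := Hy P HP). tauto. }
  generalize (filter_and _ _ HA (Hdom y Hy' eps)).
  apply filter_imp; intros z [Az Hz]; exact (Hz Az).
Qed.

(** [filterdiff] quantifies over all limit points of its filter, so the proof
    needs that [within A (locally x)] has no limit point besides [x]; since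
    [x] lies in [A], every set of this filter contains [x]. *)
Lemma is_derive_within_of_derive (A : R -> Prop) (f : R -> R) (x l : R) :
  A x -> is_derive f x l -> is_derive_within A f x l.
Proof.
  intros Ax [Hlin Hdom]; split; [exact Hlin|].
  intros y Hy eps.
  assert (Exy : x = y).
  { apply eq_close; intros d.
    destruct (Req_dec x y) as [->|Hne]; [apply ball_center|].
    exfalso.
    assert (Hd : 0 < Rabs (x - y) / 2).
    { apply Rdiv_lt_0_compat; [apply Rabs_pos_lt|]; lra. }
    pose (dd := mkposreal _ Hd).
    specialize (Hy (ball y dd) (locally_ball _ _)).
    destruct Hy as [e He].
    specialize (He x (ball_center _ _) Ax).
    change (Rabs (x - y) < Rabs (x - y) / 2) in He. lra. }
  subst y. unfold within.
  apply filter_imp with (2 := Hdom x (fun P HP => HP) eps). tauto.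
Qed.

Lemma is_derive_within_continuous_on (A : R -> Prop) (f f' : R -> R) :
  (forall x, A x -> is_derive_within A f x (f' x)) -> continuous_on A f.
Proof.
  intros Hf x Ax.
  apply (filterdiff_continuous_aux (K := R_AbsRing)
    (U := AbsRing_NormedModule R_AbsRing) (V := AbsRing_NormedModule R_AbsRing)
    (F := within A (locally x))).
  - exists (fun h : R => scal h (f' x)). exact (Hf x Ax).
  - intros P HP; unfold within. apply filter_imp with (2 := HP). tauto.
Qed.

Lemma is_derive_within_minus_scal (A : R -> Prop) (f g : R -> R)
    (x l m e : R) :
  is_derive_within A f x l -> is_derive_within A g x m ->
  is_derive_within A (fun y => f y - e * g y) x (l - e * m).
Proof.
  intros Hf Hg.
  unfold is_derive_within.
  apply (filterdiff_ext_lin _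
    (fun h : R => minus (scal h l : R) (scal e (scal h m) : R))).
  - apply (filterdiff_minus_fct f (fun y => scal e (g y))); [exact Hf|].
    apply (filterdiff_scal_r_fct e g); [exact Rmult_comm | exact Hg].
  - intros h; unfold minus, plus, opp, scal; simpl; unfold mult; simpl; ring.
Qed.

Lemma continuous_on_comp {T U V : UniformSpace} (A : T -> Prop) (B : U -> Prop)
    (psi : T -> U) (g : U -> V) :
  (forall x, A x -> continuous psi x) -> (forall x, A x -> B (psi x)) ->
  continuous_on B g -> continuous_on A (fun x => g (psi x)).
Proof.
  intros Hpsi HAB Hg x Ax P HP.
  specialize (Hg _ (HAB x Ax) P HP).
  specialize (Hpsi x Ax _ Hg).
  unfold filtermap, within in *.
  apply filter_imp with (2 := Hpsi). intros y Hy Ay. auto.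
Qed.

Lemma continuous_comp_into {T U V : UniformSpace} (B : U -> Prop)
    (psi : T -> U) (g : U -> V) :
  (forall x, continuous psi x) -> (forall x, B (psi x)) ->
  continuous_on B g -> forall x, continuous (fun y => g (psi y)) x.
Proof.
  intros Hpsi HB Hg x.
  apply (continuous_continuous_on (fun _ => True)).
  - apply filter_forall; trivial.
  - apply continuous_on_comp with (B := B); auto.
Qed.

Lemma continuous_on_minus_scal {T : UniformSpace} (A : T -> Prop)
    (f g : T -> R) (e : R) :
  continuous_on A f -> continuous_on A g ->
  continuous_on A (fun p => f p - e * g p).
Proof.
  intros Hf Hg x Ax.
  unfold Rminus.
  apply (filterlim_comp_2 (G := locally (f x)) (H := locally (- (e * g x)))
    f (fun p => - (e * g p)) Rplus).
  - exact (Hf x Ax).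
  - apply (filterlim_comp _ _ _ (fun p => e * g p) Ropp _ (locally (e * g x))).
    + apply (filterlim_comp _ _ _ g (Rmult e) _ (locally (g x))).
      * exact (Hg x Ax).
      * apply (filterlim_scal_r (V := R_NormedModule) e (g x)).
    + apply (filterlim_opp (V := R_NormedModule) (e * g x)).
  - apply (filterlim_plus (V := R_NormedModule) (f x) (- (e * g x))).
Qed.

Lemma continuous_pair {T U V : UniformSpace} (f : T -> U) (g : T -> V) (x : T) :
  continuous f x -> continuous g x -> continuous (fun y => (f y, g y)) x.
Proof.
  intros Hf Hg.
  apply (continuous_comp_2 f g (fun u v => (u, v)) x Hf Hg).
  apply (continuous_ext (fun z : U * V => z)).
  - now intros [u v].
  - apply continuous_id.
Qed.

(** * The retraction of the line onto [0,D] *)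

Definition clip (D x : R) : R := Rmax 0 (Rmin x D).

Lemma clip_space (D x : R) : 0 < D -> space D (clip D x).
Proof.
  intros HD; unfold space, clip, Rmax, Rmin.
  destruct (Rle_dec x D); destruct Rle_dec; lra.
Qed.

Lemma clip_id (D x : R) : space D x -> clip D x = x.
Proof.
  unfold space, clip, Rmax, Rmin; intros H.
  destruct (Rle_dec x D); destruct Rle_dec; lra.
Qed.

Lemma lipschitz_continuous (f : R -> R) :
  (forall x y, Rabs (f x - f y) <= Rabs (x - y)) ->
  forall x, continuous f x.
Proof.
  intros Hf x. apply filterlim_locally; intros eps.
  exists eps; intros y Hy.
  change (Rabs (f y - f x) < eps).
  change (Rabs (y - x) < eps) in Hy.
  specialize (Hf y x); lra.
Qed.

Lemma clip_continuous (D x : R) : 0 < D -> continuous (clip D) x.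
Proof.
  intros HD; apply lipschitz_continuous; clear x; intros x y.
  unfold clip, Rmax, Rmin.
  destruct (Rle_dec x D), (Rle_dec y D); repeat destruct Rle_dec;
    unfold Rabs; repeat destruct Rcase_abs; lra.
Qed.

Lemma Rmax_0_continuous (x : R) : continuous (Rmax 0) x.
Proof.
  apply lipschitz_continuous; clear x; intros x y.
  unfold Rmax; repeat destruct Rle_dec;
    unfold Rabs; repeat destruct Rcase_abs; lra.
Qed.

Lemma locally_open_interval (a b x : R) :
  a < x < b -> locally x (fun y => a < y < b).
Proof.
  intros [Ha Hb].
  apply (filter_and (fun y => a < y) (fun y => y < b)).
  - exact (open_gt a x Ha).
  - exact (open_lt b x Hb).
Qed.

(** The mean value theorem asks for two-sided continuity at the end points,
    which [fun y => f (clip D y)] has even if [f] only has it from inside. *)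
Lemma constant_of_derive_0 (D : R) (f : R -> R) :
  0 < D -> continuous_on (space D) f ->
  (forall x, 0 < x < D -> is_derive f x 0) ->
  forall x, space D x -> f x = f 0.
Proof.
  intros HD Hc Hd x Hx.
  assert (Hx' := Hx); destruct Hx' as [Hx0 HxD].
  destruct (MVT_gen (fun y => f (clip D y)) 0 x (fun _ => 0)) as [c [_ Hc']].
  - rewrite Rmin_left, Rmax_right by lra; intros y Hy.
    apply (is_derive_ext_loc f).
    + apply filter_imp with (2 := locally_open_interval 0 D y ltac:(lra)).
      intros z Hz; rewrite clip_id; [reflexivity | unfold space; lra].
    + apply Hd; lra.
  - intros y _. apply continuity_pt_filterlim.
    apply (continuous_comp_into (space D) (clip D) f); auto.
    + intros; apply clip_continuous; assumption.
    + intros; apply clip_space; assumption.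
  - rewrite (clip_id D x), (clip_id D 0) in Hc'
      by (unfold space; lra).
    lra.
Qed.

(** The fundamental theorem of calculus with one-sided derivatives at the end
    points: [f] and a primitive of [f'] have the same derivative in the
    interior, so they differ by a constant. *)
Lemma is_RInt_derive_within (D : R) (f f' : R -> R) :
  0 < D ->
  (forall x, space D x -> is_derive_within (space D) f x (f' x)) ->
  continuous_on (space D) f' ->
  is_RInt f' 0 D (f D - f 0).
Proof.
  intros HD Hd Hc.
  pose (g := fun y => f' (clip D y)).
  assert (Hg : forall y, continuous g y).
  { apply (continuous_comp_into (space D) (clip D) f'); auto.
    - intros; apply clip_continuous; assumption.
    - intros; apply clip_space; assumption. }
  assert (Hint : forall b, is_RInt g 0 b (RInt g 0 b)).
  { intros b. apply (RInt_correct (V := R_CompleteNormedModule)).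
    apply (ex_RInt_continuous (V := R_CompleteNormedModule)); auto. }
  assert (Hder : forall x, is_derive (fun b => RInt g 0 b) x (g x)).
  { intros x. apply (is_derive_RInt g (fun b => RInt g 0 b) 0).
    - apply filter_forall; exact Hint.
    - apply Hg. }
  assert (E : f D - 1 * RInt g 0 D = f 0 - 1 * RInt g 0 0).
  { apply (constant_of_derive_0 D (fun x => f x - 1 * RInt g 0 x)).
    - exact HD.
    - apply continuous_on_minus_scal.
      + apply (is_derive_within_continuous_on _ _ f'); exact Hd.
      + apply continuous_on_forall; intros x _.
        apply (ex_derive_continuous (V := R_NormedModule)).
        exists (g x); apply Hder.
    - intros x Hx.
      assert (Hs : space D x) by (unfold space; lra).
      assert (Hh : is_derive (fun y => f y - 1 * RInt g 0 y) x
                     (f' x - 1 * g x)).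
      { apply (is_derive_within_locally (fun _ => True));
          [apply filter_forall; trivial|].
        apply is_derive_within_minus_scal;
          apply is_derive_within_of_derive; trivial.
        apply (is_derive_within_locally (space D)); auto.
        apply filter_imp with (2 := locally_open_interval 0 D x Hx).
        intros z Hz; unfold space; lra. }
      replace (f' x - 1 * g x) with 0 in Hh
        by (unfold g; rewrite clip_id by exact Hs; ring).
      exact Hh.
    - unfold space; lra. }
  rewrite RInt_point in E. change (zero : R) with 0 in E.
  replace (f D - f 0) with (RInt g 0 D) by lra.
  apply (is_RInt_ext g); [|apply Hint].
  rewrite Rmin_left, Rmax_right by lra; intros x Hx.
  unfold g; rewrite clip_id; [reflexivity | unfold space; lra].
Qed.

(** * Functions with continuous first partial derivatives *)

(** With [e = 1] this gives the difference of two solutions; with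
    [e = 1] and [e = -1] it gives the two Riemann invariants. *)
Lemma C1_partials_minus_scal (D : R) (f fx ft g gx gt : R -> R -> R) (e : R) :
  C1_partials D f fx ft -> C1_partials D g gx gt ->
  C1_partials D (fun x t => f x t - e * g x t)
    (fun x t => fx x t - e * gx x t) (fun x t => ft x t - e * gt x t).
Proof.
  intros [Hfx [Hft [Hfxc Hftc]]] [Hgx [Hgt [Hgxc Hgtc]]].
  split; [|split; [|split]].
  - intros x t Hx Ht. apply is_derive_within_minus_scal; auto.
  - intros x t Hx Ht. apply is_derive_within_minus_scal; auto.
  - apply (continuous_on_minus_scal _ (fun p : R * R => fx (fst p) (snd p))
      (fun p : R * R => gx (fst p) (snd p))); assumption.
  - apply (continuous_on_minus_scal _ (fun p : R * R => ft (fst p) (snd p))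
      (fun p : R * R => gt (fst p) (snd p))); assumption.
Qed.

Definition space_time_interior (D x t : R) : Prop := 0 < x < D /\ 0 < t.

Lemma locally_2d_space_time_interior (D x t : R) :
  space_time_interior D x t -> locally_2d (space_time_interior D) x t.
Proof.
  intros [Hx Ht].
  destruct (locally_open_interval 0 D x Hx) as [d Hd].
  destruct (open_gt 0 t Ht) as [d' Hd'].
  assert (Hm : 0 < Rmin d d') by (apply Rmin_pos; [apply d | apply d']).
  exists (mkposreal _ Hm); simpl; intros u v Hu Hv.
  split.
  - apply Hd. change (Rabs (u - x) < d).
    apply Rlt_le_trans with (1 := Hu), Rmin_l.
  - apply Hd'. change (Rabs (v - t) < d').
    apply Rlt_le_trans with (1 := Hv), Rmin_r.
Qed.

Lemma C1_partials_is_derive_x (D : R) (f fx ft : R -> R -> R) (x t : R) :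
  C1_partials D f fx ft ->
  0 < x < D -> 0 <= t -> is_derive (fun y => f y t) x (fx x t).
Proof.
  intros [H _] Hx Ht.
  apply (is_derive_within_locally (space D)).
  - apply filter_imp with (2 := locally_open_interval 0 D x Hx).
    intros z Hz; unfold space; lra.
  - apply H; [unfold space; lra | exact Ht].
Qed.

Lemma C1_partials_is_derive_t (D : R) (f fx ft : R -> R -> R) (x t : R) :
  C1_partials D f fx ft ->
  space D x -> 0 < t -> is_derive (fun s => f x s) t (ft x t).
Proof.
  intros [_ [H _]] Hx Ht.
  apply (is_derive_within_locally time).
  - apply filter_imp with (2 := open_gt 0 t Ht). intros z Hz; unfold time; lra.
  - apply H; [exact Hx | unfold time; lra].
Qed.

Lemma continuity_2d_pt_interior (D : R) (f : R -> R -> R) (x t : R) :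
  continuous_on (space_time D) (fun p : R * R => f (fst p) (snd p)) ->
  space_time_interior D x t -> continuity_2d_pt f x t.
Proof.
  intros Hc Hi. apply continuity_2d_pt_filterlim.
  apply (continuous_continuous_on (space_time D)
    (fun p : R * R => f (fst p) (snd p)) (x, t)); [|exact Hc].
  generalize (proj1 (locally_2d_locally _ _ _)
    (locally_2d_space_time_interior D x t Hi)).
  apply filter_imp; intros [u v] [H1 H2]; simpl in H1, H2.
  split; simpl; unfold space, time; lra.
Qed.

Lemma C1_partials_differentiable (D : R) (f fx ft : R -> R -> R) (x t : R) :
  C1_partials D f fx ft -> space_time_interior D x t ->
  differentiable_pt_lim f x t (fx x t) (ft x t).
Proof.
  intros Hf Hi. apply filterdiff_differentiable_pt_lim.
  apply (is_derive_filterdiff f x t fx (ft x t)).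
  - generalize (proj1 (locally_2d_locally _ _ _)
      (locally_2d_space_time_interior D x t Hi)).
    apply filter_imp; intros [u v] [H1 H2]; simpl in *.
    apply (C1_partials_is_derive_x D f fx ft); [assumption..|lra].
  - destruct Hi as [H1 H2].
    apply (C1_partials_is_derive_t D f fx ft); [assumption| |assumption].
    unfold space; lra.
  - apply continuity_2d_pt_filterlim.
    apply (continuity_2d_pt_interior D); [apply Hf | exact Hi].
Qed.

(** Schwarz's theorem; only interior points are covered, which suffices because
    characteristics meet the boundary at isolated points only. *)
Lemma C2_partials_symmetric (D : R) (w wx wt wxx wxt wtx wtt : R -> R -> R)
    (x t : R) :
  C1_partials D w wx wt -> C1_partials D wx wxx wxt ->
  C1_partials D wt wtx wtt -> space_time_interior D x t ->
  wtx x t = wxt x t.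
Proof.
  intros Hw Hwx Hwt Hi.
  assert (Dx : forall u v, space_time_interior D u v ->
    is_derive (fun z => w z v) u (wx u v)).
  { intros u v [Hu Hv].
    apply (C1_partials_is_derive_x D w wx wt); [assumption..|lra]. }
  assert (Dt : forall u v, space_time_interior D u v ->
    is_derive (fun z => w u z) v (wt u v)).
  { intros u v [Hu Hv].
    apply (C1_partials_is_derive_t D w wx wt); trivial; unfold space; lra. }
  assert (Dtx : forall u v, space_time_interior D u v ->
    is_derive (fun z => Derive (fun s => w z s) v) u (wtx u v)).
  { intros u v [Hu Hv].
    apply (is_derive_ext_loc (fun z => wt z v)).
    - apply filter_imp with (2 := locally_open_interval 0 D u Hu).
      intros z Hz; symmetry; apply is_derive_unique, Dt; split; trivial.
    - apply (C1_partials_is_derive_x D wt wtx wtt); [assumption..|lra]. }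
  assert (Dxt : forall u v, space_time_interior D u v ->
    is_derive (fun z => Derive (fun s => w s z) u) v (wxt u v)).
  { intros u v [Hu Hv].
    apply (is_derive_ext_loc (fun z => wx u z)).
    - apply filter_imp with (2 := open_gt 0 v Hv).
      intros z Hz; symmetry; apply is_derive_unique, Dx; split; trivial.
    - apply (C1_partials_is_derive_t D wx wxx wxt); trivial; unfold space; lra. }
  rewrite <- (is_derive_unique _ _ _ (Dtx x t Hi)).
  rewrite <- (is_derive_unique _ _ _ (Dxt x t Hi)).
  apply Schwarz.
  - apply locally_2d_impl with (2 := locally_2d_space_time_interior D x t Hi).
    apply locally_2d_forall; intros u v Huv.
    split; [exists (wx u v); auto|].
    split; [exists (wt u v); auto|].
    split; [exists (wtx u v); auto | exists (wxt u v); auto].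
  - apply (continuity_2d_pt_ext_loc wtx).
    + apply locally_2d_impl with (2 := locally_2d_space_time_interior D x t Hi).
      apply locally_2d_forall; intros u v Huv.
      symmetry; apply is_derive_unique; auto.
    + apply (continuity_2d_pt_interior D); [apply Hwt | exact Hi].
  - apply (continuity_2d_pt_ext_loc wxt).
    + apply locally_2d_impl with (2 := locally_2d_space_time_interior D x t Hi).
      apply locally_2d_forall; intros u v Huv.
      symmetry; apply is_derive_unique; auto.
    + apply (continuity_2d_pt_interior D); [apply Hwx | exact Hi].
Qed.

(** A transport equation makes [f] constant on the lines of slope [e]: the
    derivative of [f] along such a line vanishes in the interior, and continuity
    of [f] up to the boundary covers the end points. *)
Lemma constant_along_line (D : R) (f fx ft : R -> R -> R) (x t e L : R) :
  C1_partials D f fx ft ->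
  continuous_on (space_time D) (fun p : R * R => f (fst p) (snd p)) ->
  (forall y s, space_time_interior D y s -> fx y s * e + ft y s = 0) ->
  0 < L -> 0 <= t -> space D x -> space D (x + e * L) ->
  (forall s, 0 < s < L -> 0 < x + e * s < D) ->
  f (x + e * L) (t + L) = f x t.
Proof.
  intros Hf Hc H0 HL Ht Hx HxL Hin.
  assert (Hin' : forall s, space L s -> space_time D (x + e * s, t + s)).
  { intros s [Hs0 HsL]; split; simpl; [|unfold time; lra].
    destruct Hs0 as [Hs0| <-]; [|now rewrite Rmult_0_r, Rplus_0_r].
    destruct HsL as [HsL| ->]; [|exact HxL].
    specialize (Hin s (conj Hs0 HsL)); unfold space; lra. }
  rewrite (constant_of_derive_0 L (fun s => f (x + e * s) (t + s)) HL).
  - now rewrite Rmult_0_r, !Rplus_0_r.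
  - apply (continuous_on_comp (space L) (space_time D)
      (fun s => (x + e * s, t + s)) (fun p : R * R => f (fst p) (snd p)));
      trivial.
    intros s _.
    apply continuous_pair.
    + apply (ex_derive_continuous (V := R_NormedModule)
        (fun s => x + e * s)). auto_derive; trivial.
    + apply (ex_derive_continuous (V := R_NormedModule)
        (fun s => t + s)). auto_derive; trivial.
  - intros s Hs.
    assert (Hi : space_time_interior D (x + e * s) (t + s)).
    { split; [exact (Hin s Hs) | lra]. }
    rewrite <- (H0 _ _ Hi).
    apply is_derive_Reals.
    replace (ft (x + e * s) (t + s)) with (ft (x + e * s) (t + s) * 1) by ring.
    apply (derivable_pt_lim_comp_2d f (fun s => x + e * s) (fun s => t + s)).
    + apply (C1_partials_differentiable D); assumption.
    + apply is_derive_Reals; auto_derive; trivial; ring.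
    + apply is_derive_Reals; auto_derive; trivial; ring.
  - unfold space; lra.
Qed.

(** * Consequences of the integral condition *)

(** Differentiation under the integral sign.  Continuity of the derivative is
    required in a full neighbourhood of each point with [x = 0] or [x = D], hence
    the retractions in both variables. *)
Lemma RInt_partial_t_eq_0 (D : R) (f fx ft : R -> R -> R) :
  0 < D -> C1_partials D f fx ft ->
  (forall t, 0 < t -> is_RInt (fun y => f y t) 0 D 0) ->
  forall t, 0 < t -> RInt (fun y => ft y t) 0 D = 0.
Proof.
  intros HD Hf H0 t Ht.
  pose (g := fun s y => f (clip D y) s).
  assert (Dg : forall s y, 0 < s ->
    is_derive (fun z => g z y) s (ft (clip D y) s)).
  { intros s y Hs. apply (C1_partials_is_derive_t D f fx ft); trivial.
    now apply clip_space. }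
  assert (Hg : forall s, 0 < s -> is_RInt (fun y => g s y) 0 D 0).
  { intros s Hs. apply (is_RInt_ext (fun y => f y s)); [|now apply H0].
    rewrite Rmin_left, Rmax_right by lra; intros y Hy.
    unfold g; rewrite clip_id; [reflexivity | unfold space; lra]. }
  assert (Hd : is_derive (fun s => RInt (fun y => g s y) 0 D) t
    (RInt (fun y => Derive (fun s => g s y) t) 0 D)).
  { apply is_derive_RInt_param.
    - apply filter_imp with (2 := open_gt 0 t Ht).
      intros s Hs y _. exists (ft (clip D y) s). now apply Dg.
    - intros y _.
      apply (continuity_2d_pt_ext_loc (fun s z => ft (clip D z) (Rmax 0 s))).
      + apply locally_2d_locally.
        destruct (open_gt 0 t Ht) as [d Hd].
        exists d; intros [s z] [Hs _]; simpl in *.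
        specialize (Hd s Hs).
        rewrite (Rmax_right 0 s) by lra.
        symmetry; apply is_derive_unique, Dg; exact Hd.
      + apply continuity_2d_pt_filterlim.
        apply (continuous_comp_into (space_time D)
          (fun p : R * R => (clip D (snd p), Rmax 0 (fst p)))
          (fun p : R * R => ft (fst p) (snd p))).
        * intros [s z]. apply continuous_pair.
          -- apply (continuous_comp snd (clip D)).
             ++ apply continuous_snd.
             ++ now apply clip_continuous.
          -- apply (continuous_comp fst (Rmax 0)).
             ++ apply continuous_fst.
             ++ apply Rmax_0_continuous.
        * intros [s z]; split; simpl; [now apply clip_space|].
          unfold time; apply Rmax_l.
        * apply Hf.
    - apply filter_imp with (2 := open_gt 0 t Ht).
      intros s Hs. exists 0. now apply Hg. }
  rewrite (RInt_ext _ (fun y => Derive (fun s => g s y) t)).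
  - rewrite <- (is_derive_unique _ _ _ Hd).
    apply is_derive_unique.
    apply (is_derive_ext_loc (fun _ => 0)).
    + apply filter_imp with (2 := open_gt 0 t Ht).
      intros s Hs. symmetry. apply is_RInt_unique. now apply Hg.
    + apply (is_derive_const (V := R_NormedModule)).
  - rewrite Rmin_left, Rmax_right by lra; intros y Hy.
    symmetry; apply is_derive_unique.
    assert (Hy' := Dg t y Ht).
    rewrite clip_id in Hy' by (unfold space; lra). exact Hy'.
Qed.

Lemma continuous_on_slice (D t : R) (f : R -> R -> R) :
  time t ->
  continuous_on (space_time D) (fun p : R * R => f (fst p) (snd p)) ->
  continuous_on (space D) (fun y => f y t).
Proof.
  intros Ht Hf.
  apply (continuous_on_comp (space D) (space_time D) (fun y => (y, t))
    (fun p : R * R => f (fst p) (snd p))); trivial.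
  - intros y _. apply continuous_pair; [apply continuous_id|].
    apply continuous_const.
  - intros y Hy; split; trivial.
Qed.

Lemma is_RInt_slice (D t : R) (f : R -> R -> R) :
  0 < D -> time t ->
  continuous_on (space_time D) (fun p : R * R => f (fst p) (snd p)) ->
  is_RInt (fun y => f y t) 0 D (RInt (fun y => f y t) 0 D).
Proof.
  intros HD Ht Hf. apply (RInt_correct (V := R_CompleteNormedModule)).
  apply (ex_RInt_ext (fun y => f (clip D y) t)).
  - rewrite Rmin_left, Rmax_right by lra; intros y Hy.
    rewrite clip_id; [reflexivity | unfold space; lra].
  - apply (ex_RInt_continuous (V := R_CompleteNormedModule)); intros y _.
    apply (continuous_comp_into (space D) (clip D) (fun y => f y t)).
    + intros; now apply clip_continuous.
    + intros; now apply clip_space.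
    + now apply continuous_on_slice.
Qed.

(** The second time derivative of the zero integral is the integral of
    [wtt = wxx], that is, the difference of the boundary values of [wx]. *)
Lemma flux_balance (D : R) (w wx wt wxx wxt wtx wtt : R -> R -> R) :
  0 < D ->
  C1_partials D w wx wt -> C1_partials D wx wxx wxt ->
  C1_partials D wt wtx wtt ->
  (forall x t, space D x -> time t -> wtt x t = wxx x t) ->
  (forall t, time t -> is_RInt (fun y => w y t) 0 D 0) ->
  forall t, 0 < t -> wx D t = wx 0 t.
Proof.
  intros HD Hw Hwx Hwt Hwave Hint t Ht.
  assert (Ht' : time t) by (unfold time; lra).
  assert (E1 : forall s, 0 < s -> is_RInt (fun y => wt y s) 0 D 0).
  { intros s Hs.
    assert (I := is_RInt_slice D s wt HD ltac:(unfold time; lra)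
      ltac:(apply Hw)).
    rewrite (RInt_partial_t_eq_0 D w wx wt HD Hw) in I; trivial.
    intros r Hr; apply Hint; unfold time; lra. }
  assert (E2 := RInt_partial_t_eq_0 D wt wtx wtt HD Hwt E1 t Ht).
  assert (E3 : is_RInt (fun y => wxx y t) 0 D (wx D t - wx 0 t)).
  { apply (is_RInt_derive_within D (fun y => wx y t) (fun y => wxx y t) HD).
    - intros x Hx; now apply Hwx.
    - apply continuous_on_slice; [trivial | apply Hwx]. }
  apply (is_RInt_unique (V := R_CompleteNormedModule)) in E3.
  rewrite (RInt_ext _ (fun y => wtt y t)) in E3.
  - rewrite E2 in E3; lra.
  - rewrite Rmin_left, Rmax_right by lra; intros y Hy.
    symmetry; apply Hwave; [unfold space; lra | trivial].
Qed.

(** * Uniqueness by characteristics *)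

(** For [e = 1] and [e = -1] the wave equation factors as
    (d_t + e d_x) (w_t - e w_x) = 0. *)
Lemma riemann_invariant_constant (D e : R) (w wx wt wxx wxt wtx wtt : R -> R -> R)
    (x t L : R) :
  e * e = 1 ->
  C1_partials D w wx wt -> C1_partials D wx wxx wxt ->
  C1_partials D wt wtx wtt ->
  (forall x t, space D x -> time t -> wtt x t = wxx x t) ->
  0 <= L -> 0 <= t -> space D x -> space D (x + e * L) ->
  wt (x + e * L) (t + L) - e * wx (x + e * L) (t + L)
    = wt x t - e * wx x t.
Proof.
  intros He Hw Hwx Hwt Hwave [HL| <-] Ht Hx HxL;
    [|now rewrite Rmult_0_r, !Rplus_0_r].
  apply (constant_along_line D (fun x t => wt x t - e * wx x t) _ _ x t e L
    (C1_partials_minus_scal D _ _ _ _ _ _ e Hwt Hwx)); trivial.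
  - apply (continuous_on_minus_scal _ (fun p : R * R => wt (fst p) (snd p))
      (fun p : R * R => wx (fst p) (snd p))); [apply Hw | apply Hw].
  - intros y s Hi.
    rewrite (C2_partials_symmetric D w wx wt wxx wxt wtx wtt y s) by trivial.
    destruct Hi as [Hy Hs].
    rewrite Hwave by (unfold space, time; lra).
    replace (_ + _) with (wxx y s * (1 - e * e)) by ring.
    rewrite He; ring.
  - intros s Hs; unfold space in *.
    assert (He' : e = 1 \/ e = -1).
    { assert (Hp : (e - 1) * (e + 1) = 0) by lra.
      apply Rmult_integral in Hp; lra. }
    destruct He' as [-> | ->]; lra.
Qed.

(** Zero Cauchy data on the side [x = D] determine [w], for all times, with the
    help of the reflection at [x = 0]. *)
Lemma wave_unique_continuation (D : R) (w wx wt wxx wxt wtx wtt : R -> R -> R) :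
  0 < D ->
  C1_partials D w wx wt -> C1_partials D wx wxx wxt ->
  C1_partials D wt wtx wtt ->
  (forall x t, space D x -> time t -> wtt x t = wxx x t) ->
  (forall t, time t -> wx 0 t = 0) ->
  (forall t, 0 < t -> wx D t = 0) ->
  (forall t, time t -> w D t = 0) ->
  forall x t, space D x -> time t -> w x t = 0.
Proof.
  intros HD Hw Hwx Hwt Hwave H0 HxD HwD.
  assert (HDs : space D D) by (unfold space; lra).
  assert (H0s : space D 0) by (unfold space; lra).
  assert (HtD : forall t, 0 < t -> wt D t = 0).
  { intros t Ht.
    rewrite <- (is_derive_unique _ _ _
      (C1_partials_is_derive_t D w wx wt D t Hw HDs Ht)).
    apply is_derive_unique, (is_derive_ext_loc (fun _ => 0)).
    - apply filter_imp with (2 := open_gt 0 t Ht).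
      intros s Hs; symmetry; apply HwD; unfold time; lra.
    - apply (is_derive_const (V := R_NormedModule)). }
  assert (Hq : forall x t, space D x -> 0 < t -> wt x t - wx x t = 0).
  { intros x t Hx Ht; unfold space in Hx.
    (* The characteristic through [(x, t)] reaches [x = D] after time [D - x]. *)
    assert (E := riemann_invariant_constant D 1 w wx wt wxx wxt wtx wtt x t (D - x)
      ltac:(lra) Hw Hwx Hwt Hwave ltac:(lra) ltac:(lra) Hx
      ltac:(unfold space; lra)).
    replace (x + 1 * (D - x)) with D in E by ring.
    rewrite HtD, HxD in E by lra. lra. }
  assert (Hp : forall x t, space D x -> 0 < t -> wt x t + wx x t = 0).
  { intros x t Hx Ht; unfold space in Hx.
    (* The characteristic through [(x, t)] reaches [x = 0] after time [x], and
       there both invariants equal [wt]. *)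
    assert (E := riemann_invariant_constant D (-1) w wx wt wxx wxt wtx wtt x t x
      ltac:(lra) Hw Hwx Hwt Hwave ltac:(lra) ltac:(lra) Hx
      ltac:(unfold space; lra)).
    replace (x + -1 * x) with 0 in E by ring.
    assert (Hq0 := Hq 0 (t + x) H0s ltac:(lra)).
    rewrite H0 in Hq0, E by (unfold time; lra). lra. }
  assert (Hpos : forall x t, space D x -> 0 < t -> w x t = 0).
  { intros x t Hx Ht.
    assert (Hs : time t) by (unfold time; lra).
    assert (E : forall y, space D y -> w y t = w 0 t).
    { apply (constant_of_derive_0 D (fun y => w y t) HD).
      - apply (is_derive_within_continuous_on _ _ (fun y => wx y t)).
        intros y Hy; now apply Hw.
      - intros y Hy.
        assert (Hy' : space D y) by (unfold space; lra).
        replace 0 with (wx y t)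
          by (specialize (Hq y t Hy' Ht); specialize (Hp y t Hy' Ht); lra).
        apply (C1_partials_is_derive_x D w wx wt); trivial. }
    rewrite E by trivial. rewrite <- (E D HDs). now apply HwD. }
  intros x t Hx [Ht| <-]; [now apply Hpos|].
  (* At [t = 0] one argues by continuity, as [w x] vanishes for positive times. *)
  transitivity (w x 1); [symmetry | exact (Hpos x 1 Hx Rlt_0_1)].
  apply (constant_of_derive_0 1 (fun s => w x s) Rlt_0_1).
  - apply (continuous_on_subset time); [unfold space, time; intros; lra|].
    apply (is_derive_within_continuous_on _ _ (fun s => wt x s)).
    intros s Hs; now apply Hw.
  - intros s Hs. apply (is_derive_ext_loc (fun _ => 0)).
    + apply filter_imp with (2 := open_gt 0 s (proj1 Hs)).
      intros r Hr; symmetry; now apply Hpos.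
    + apply (is_derive_const (V := R_NormedModule)).
  - unfold space; lra.
Qed.

(** * The standing wave *)

Lemma C1_partials_separated (D : R) (f f' g g' : R -> R) :
  (forall x, is_derive f x (f' x)) -> (forall t, is_derive g t (g' t)) ->
  (forall x, continuous f' x) -> (forall t, continuous g' t) ->
  C1_partials D (fun x t => f x * g t)
    (fun x t => f' x * g t) (fun x t => f x * g' t).
Proof.
  intros Hf Hg Hf' Hg'.
  assert (Hprod : forall u v : R -> R,
    (forall x, continuous u x) -> (forall x, continuous v x) ->
    continuous_on (space_time D) (fun p : R * R => u (fst p) * v (snd p))).
  { intros u v Hu Hv. apply continuous_on_forall; intros [x t] _.
    apply (continuous_mult (fun p : R * R => u (fst p))
      (fun p : R * R => v (snd p))).
    - apply (continuous_comp fst u); [apply continuous_fst | apply Hu].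
    - apply (continuous_comp snd v); [apply continuous_snd | apply Hv]. }
  assert (Cf : forall x, continuous f x).
  { intros x; apply (ex_derive_continuous (V := R_NormedModule)).
    exists (f' x); apply Hf. }
  assert (Cg : forall x, continuous g x).
  { intros x; apply (ex_derive_continuous (V := R_NormedModule)).
    exists (g' x); apply Hg. }
  split; [|split; [|split; now apply Hprod]]; intros x t Hx Ht.
  - apply is_derive_within_of_derive; [trivial|].
    apply (is_derive_ext (fun y => scal (g t) (f y))).
    + intros y; apply Rmult_comm.
    + replace (f' x * g t) with (scal (g t) (f' x)) by apply Rmult_comm.
      apply is_derive_scal, Hf.
  - apply is_derive_within_of_derive; [trivial|].
    apply is_derive_scal, Hg.
Qed.

Lemma sin_ne_0_of_nonresonant (D omega : R) :
  0 < D -> 0 < omega -> (forall k : nat, omega <> INR k * PI / D) ->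
  sin (omega * D) <> 0.
Proof.
  intros HD Ho Hk Hs.
  destruct (sin_eq_0_0 _ Hs) as [k Ek].
  assert (Hpos : 0 < IZR k * PI) by (rewrite <- Ek; now apply Rmult_lt_0_compat).
  assert (k0 : (0 <= k)%Z).
  { apply le_IZR. apply Rlt_le, (Rmult_lt_reg_r PI); [apply PI_RGT_0 | lra]. }
  apply (Hk (Z.to_nat k)).
  rewrite INR_IZR_INZ, Z2Nat.id by trivial.
  rewrite <- Ek; field; lra.
Qed.

Lemma standing_wave_trajectory (a D omega : R) :
  0 < D -> 0 < omega -> sin (omega * D) <> 0 ->
  trajectory_generation D a omega
    (fun x t => a * omega / sin (omega * D) * cos (omega * x) * sin (omega * t))
    (fun t => a * omega / sin (omega * D) * cos (omega * D) * sin (omega * t)).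
Proof.
  intros HD Ho Hs.
  set (K := a * omega / sin (omega * D)).
  pose (c0 := fun x => K * cos (omega * x)).
  pose (c1 := fun x => - (K * omega) * sin (omega * x)).
  pose (c2 := fun x => - (K * omega * omega) * cos (omega * x)).
  pose (s0 := fun t => sin (omega * t)).
  pose (s1 := fun t => omega * cos (omega * t)).
  pose (s2 := fun t => - (omega * omega) * sin (omega * t)).
  assert (Dc0 : forall x, is_derive c0 x (c1 x))
    by (intros x; unfold c0, c1; auto_derive; trivial; ring).
  assert (Dc1 : forall x, is_derive c1 x (c2 x))
    by (intros x; unfold c1, c2; auto_derive; trivial; ring).
  assert (Ds0 : forall x, is_derive s0 x (s1 x))
    by (intros x; unfold s0, s1; auto_derive; trivial; ring).
  assert (Ds1 : forall x, is_derive s1 x (s2 x))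
    by (intros x; unfold s1, s2; auto_derive; trivial; ring).
  assert (Cc1 : forall x, continuous c1 x)
    by (intros x; apply (ex_derive_continuous (V := R_NormedModule));
        exists (c2 x); auto).
  assert (Cs1 : forall x, continuous s1 x)
    by (intros x; apply (ex_derive_continuous (V := R_NormedModule));
        exists (s2 x); auto).
  assert (Cc2 : forall x, continuous c2 x)
    by (intros x; apply (ex_derive_continuous (V := R_NormedModule));
        unfold c2; auto_derive; trivial).
  assert (Cs2 : forall x, continuous s2 x)
    by (intros x; apply (ex_derive_continuous (V := R_NormedModule));
        unfold s2; auto_derive; trivial).
  (* All partial derivatives are products of a derivative of [c0] and one of [s0]. *)
  exists (fun x t => c1 x * s0 t), (fun x t => c0 x * s1 t),
    (fun x t => c2 x * s0 t), (fun x t => c1 x * s1 t),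
    (fun x t => c1 x * s1 t), (fun x t => c0 x * s2 t).
  split; [now apply (C1_partials_separated D c0 c1 s0 s1)|].
  split; [now apply (C1_partials_separated D c1 c2 s0 s1)|].
  split; [now apply (C1_partials_separated D c0 c1 s1 s2)|].
  split; [|split; [|split]].
  - intros t _.
    assert (I := is_RInt_derive (V := R_CompleteNormedModule)
      (fun y => K / omega * sin (omega * y) * sin (omega * t))
      (fun y => K * cos (omega * y) * sin (omega * t)) 0 D).
    replace (a * sin (omega * t)) with
      (minus (K / omega * sin (omega * D) * sin (omega * t))
         (K / omega * sin (omega * 0) * sin (omega * t)) : R).
    + apply I; intros y _.
      * auto_derive; trivial. field; lra.
      * apply (ex_derive_continuous (V := R_NormedModule)); auto_derive; trivial.
    + rewrite Rmult_0_r, sin_0. unfold K, minus, plus, opp; simpl.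
      field; split; trivial; lra.
  - intros x t _ _; unfold c0, s2, c2, s0; ring.
  - intros t _; unfold c1; rewrite Rmult_0_r, sin_0; ring.
  - reflexivity.
Qed.

(** * Uniqueness of the trajectory for a given boundary signal *)

Lemma trajectory_generation_unique (D a omega : R) (beta1 beta2 : R -> R -> R)
    (S : R -> R) :
  0 < D ->
  trajectory_generation D a omega beta1 S ->
  trajectory_generation D a omega beta2 S ->
  forall x t, space D x -> time t -> beta1 x t = beta2 x t.
Proof.
  intros HD
    (bx & bt & bxx & bxt & btx & btt & Hb & Hbx & Hbt & Ib & Wb & Nb & Sb)
    (cx & ct & cxx & cxt & ctx & ctt & Hc & Hcx & Hct & Ic & Wc & Nc & Sc)
    x t Hx Ht.
  assert (Hw := C1_partials_minus_scal D _ _ _ _ _ _ 1 Hb Hc).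
  assert (Hwx := C1_partials_minus_scal D _ _ _ _ _ _ 1 Hbx Hcx).
  assert (Hwt := C1_partials_minus_scal D _ _ _ _ _ _ 1 Hbt Hct).
  assert (Hwave : forall x t, space D x -> time t ->
    btt x t - 1 * ctt x t = bxx x t - 1 * cxx x t)
    by (intros; rewrite Wb, Wc; trivial).
  assert (Hneu : forall t, time t -> bx 0 t - 1 * cx 0 t = 0)
    by (intros; rewrite Nb, Nc by trivial; ring).
  enough (E : beta1 x t - 1 * beta2 x t = 0) by lra.
  apply (wave_unique_continuation D
    (fun x t => beta1 x t - 1 * beta2 x t) _ _ _ _ _ _ HD Hw Hwx Hwt);
    trivial.
  - intros s Hs.
    rewrite (flux_balance D _ _ _ _ _ _ _ HD Hw Hwx Hwt Hwave); trivial.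
    + apply Hneu; unfold time; lra.
    + intros r Hr.
      assert (I := is_RInt_minus (V := R_NormedModule) _ _ _ _ _ _
        (Ib r Hr) (Ic r Hr)).
      rewrite minus_eq_zero in I.
      revert I; apply is_RInt_ext; intros y _.
      unfold minus, plus, opp; simpl; ring.
  - intros s Hs; rewrite Sb, Sc by trivial; ring.
Qed.

Theorem lemma1 (a D omega : R) (ha : 0 < a) (hD : 0 < D) (homega : 0 < omega)
    (hfreq : forall k : nat, omega <> INR k * PI / D) :
  let beta := fun x t : R =>
    a * omega / sin (omega * D) * cos (omega * x) * sin (omega * t) in
  let S := fun t : R =>
    a * omega / sin (omega * D) * cos (omega * D) * sin (omega * t) in
  trajectory_generation D a omega beta S /\
  (forall beta' : R -> R -> R, trajectory_generation D a omega beta' S ->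
     forall x t : R, space D x -> time t -> beta' x t = beta x t) /\
  (forall S' : R -> R, trajectory_generation D a omega beta S' ->
     forall t : R, time t -> S' t = beta D t /\ beta D t = S t).
Proof.
  intros beta S.
  assert (Hsol : trajectory_generation D a omega beta S).
  { apply standing_wave_trajectory; trivial.
    now apply sin_ne_0_of_nonresonant. }
  split; [exact Hsol|]; split.
  - intros beta' H'. now apply (trajectory_generation_unique D a omega _ _ S).
  - intros S' (bx & bt & bxx & bxt & btx & btt & H') t Ht.
    split; [|reflexivity].
    symmetry; now apply H'.
Qed.
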